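(* Let $(A,\phi)$ be a non-commutative probability space with unital linear map $\phi:A\to k$, and let $\Phi:H=\overline T(T(A))\to k$ be its extension as a character. Let $\rho:\overline T(T(A))\to k$ be the infinitesimal character solving $\Phi=\exp^*(\rho)$, i.e. $\rho=\log^*(\Phi)$. For $a\in A$ set $h_n:=\rho(a^{n})$ for $n\ge 1$ and $m_l:=\Phi(a^{l})=\phi(a^l)$ for $l\ge 0$, where $a^n$ denotes the word $a\cdots a=a^{\otimes n}$ of length $n$. Then for all $n\ge 1$ $$m_n=\sum_{s=1}^n\ \sum_{1=i_0<i_1<\cdots<i_{s-1}<i_s=n+1}\frac{1}{s!}\prod_{j=1}^s i_{j-1}\,h_{i_j-i_{j-1}}.$$ In particular, the $h_n$ are the monotone cumulants of $a$.
   Context: $k$ is a field of characteristic zero. A non-commutative probability space $(A,\phi)$ is an associative unital $k$-algebra $A$ (product $\cdot_A$, unit $1_A$) with a $k$-linear form $\phi:A\to k$ with $\phi(1_A)=1$. Double tensor algebra. $T(A)=\bigoplus_{n>0}A^{\otimes n}$ and $\overline T(A)=\bigoplus_{n\ge0}A^{\otimes n}$; the tensor $a_1\otimes\cdots\otimes a_n$ is written as a word $a_1\cdots a_n$ (not to be confused with the product $a_1\cdot_A\cdots\cdot_A a_n$ in $A$). $H:=\overline T(T(A))=\bigoplus_{n\ge0}T(A)^{\otimes n}$ is the unital algebra spanned by bar words $w_1|\cdots|w_m$ ($w_i\in T(A)$), with product the concatenation $|$ and unit $\mathbf 1$ (the empty word is identified with $\mathbf 1$); it is graded by the total number of letters.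 $H^+:=T(T(A))=\bigoplus_{n>0}T(A)^{\otimes n}$. Coproduct. For $S=\{s_1<\cdots<s_p\}\subseteq[n]=\{1,\dots,n\}$ put $a_S:=a_{s_1}\cdots a_{s_p}$, $a_\emptyset:=\mathbf 1$. If $J_1,\dots,J_l$ are the connected components (maximal intervals of consecutive integers, in increasing order) of $[n]\setminus S$, put $a_{J^S_{[n]}}:=a_{J_1}|\cdots|a_{J_l}$ ($=\mathbf 1$ if $S=[n]$). The coproduct $\Delta:H\to H\otimes H$ is given by $\Delta(\mathbf 1)=\mathbf 1\otimes\mathbf 1$, $\Delta(a_1\cdots a_n)=\sum_{S\subseteq[n]}a_S\otimes a_{J^S_{[n]}}$, and is extended multiplicatively to $H$. It is known that $H$ is a connected graded Hopf algebra; its counit is denoted $\epsilon$. Characters. On $\mathcal L_A:=Lin(H,k)$ the convolution product is $f*g:=m_k\circ(f\otimes g)\circ\Delta$ ($m_k$ the product of $k$), with unit $\epsilon$. A character is $\Phi\in\mathcal L_A$ with $\Phi(\mathbf 1)=1$ and $\Phi(w_1|w_2)=\Phi(w_1)\Phi(w_2)$ for $w_1,w_2\in H$. An infinitesimal character is $\kappa\in\mathcal L_A$ with $\kappa(\mathbf 1)=0$ and $\kappa(w_1|w_2)=0$ for $w_1,w_2\in H^+$. The maps $\exp^*(\alpha)=\sum_{j\ge0}\frac1{j!}\alpha^{*j}$ and $\log^*(\epsilon+\gamma)=\sum_{l\ge1}\frac{(-1)^{l-1}}{l}\gamma^{*l}$ (finite sums when evaluated on any element) are mutually inverse bijections between infinitesimal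 characters and characters. Extension of $\phi$. $\phi$ is extended to $T(A)$ by $\phi(a_1\cdots a_n):=\phi(a_1\cdot_A\cdots\cdot_A a_n)$, and then to the character $\Phi$ by $\Phi(\mathbf 1)=1$, $\Phi(w_1|\cdots|w_m):=\phi(w_1)\cdots\phi(w_m)$. The (univariate) monotone cumulants of $a$ are the scalars $(h_n)_{n\ge1}$ uniquely determined from the moments $m_n=\phi(a\cdot_A\cdots\cdot_A a)$ by the Hasebe–Saigo monotone moment–cumulant relation, which is the displayed formula. *)

(* Defs.v *)
From HB Require Import structures.
From mathcomp Require Import all_boot all_algebra.
From mathcomp Require Import boolp classical_sets fsbigop.
From mathcomp Require Import finmap monalg.

Set Implicit Arguments.
Unset Strict Implicit.
Unset Printing Implicit Defensive.

Import GRing.Theory.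
Local Open Scope ring_scope.

Section Presented.
Variables (k : fieldType) (X : choiceType) (R : {malg k[X]} -> Prop).
Implicit Types (x y : {malg k[X]}) (p : X).

Inductive spanned : {malg k[X]} -> Prop :=
| spanned_0 : spanned 0
| spanned_Z c r x of R r & spanned x : spanned (c *: r + x).

Definition relspan : {pred {malg k[X]}} := fun x => `[< spanned x >].

Lemma spannedP x : reflect (spanned x) (x \in relspan).
Proof. exact: asboolP. Qed.

Lemma spannedD x y : spanned x -> spanned y -> spanned (x + y).
Proof.
elim=> [|c r x' Rr _ IH] sy; first by rewrite add0r.
by rewrite -addrA; apply: spanned_Z => //; apply: IH.
Qed.

Lemma spannedZ c x : spanned x -> spanned (c *: x).
Proof.
elim=> [|d r x' Rr _ IH]; first by rewrite scaler0; constructor.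
by rewrite scalerDr scalerA; constructor.
Qed.

Lemma relspan_zmod_closed : zmod_closed relspan.
Proof.
split=> [|x y /spannedP sx /spannedP sy]; apply/spannedP; first by constructor.
by apply: spannedD => //; rewrite -scaleN1r; apply: spannedZ.
Qed.

HB.instance Definition _ :=
  GRing.isZmodClosed.Build {malg k[X]} relspan relspan_zmod_closed.

Definition presented := Quotient.quot relspan.
HB.instance Definition _ := GRing.Zmodule.on presented.

(* Here and below, locked only serves to keep unification from unfolding. *)
Definition pi_pres : {malg k[X]} -> presented := locked \pi_presented%qT.

Lemma pi_presB x y : pi_pres (x - y) = pi_pres x - pi_pres y.
Proof. by rewrite /pi_pres -lock; apply: raddfB. Qed.

Lemma pi_presD x y : pi_pres (x + y) = pi_pres x + pi_pres y.
Proof. by rewrite /pi_pres -lock; apply: raddfD. Qed.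

Lemma pi_pres0 : pi_pres 0 = 0.
Proof. by rewrite /pi_pres -lock; apply: raddf0. Qed.

Lemma pi_pres_eq x y : pi_pres x = pi_pres y <-> spanned (x - y).
Proof.
rewrite /pi_pres -lock; split=> [|/spannedP sxy].
  by move/eqP; rewrite -Quotient.idealrBE => /spannedP.
by apply/eqP; rewrite -Quotient.idealrBE.
Qed.

Lemma repr_pi_pres x : spanned (repr (pi_pres x) - x).
Proof. by apply/pi_pres_eq; rewrite /pi_pres -lock reprK. Qed.

Lemma pi_pres_repr (q : presented) : pi_pres (repr q) = q.
Proof. by rewrite /pi_pres -lock reprK. Qed.

Definition pres_scale (c : k) : presented -> presented :=
  locked (fun q => pi_pres (c *: repr q)).

Lemma pi_presZ c x : pi_pres (c *: x) = pres_scale c (pi_pres x).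
Proof.
rewrite /pres_scale -lock; apply/esym/pi_pres_eq; rewrite -scalerBr; exact/spannedZ/repr_pi_pres.
Qed.

Fact pres_scaleA c d q : pres_scale c (pres_scale d q) = pres_scale (c * d) q.
Proof. by rewrite -[q]pi_pres_repr -!pi_presZ scalerA. Qed.
Fact pres_scale1 : left_id 1 pres_scale.
Proof. by move=> q; rewrite -[q]pi_pres_repr -!pi_presZ scale1r. Qed.
Fact pres_scaleDr : right_distributive pres_scale +%R.
Proof.
move=> c q r; rewrite -[q]pi_pres_repr -[r]pi_pres_repr.
by rewrite -pi_presD -!pi_presZ -pi_presD scalerDr.
Qed.
Fact pres_scaleDl q : {morph pres_scale^~ q : c d / c + d}.
Proof.
by move=> c d; rewrite -[q]pi_pres_repr -!pi_presZ -pi_presD scalerDl.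
Qed.

HB.instance Definition _ := GRing.Zmodule_isLmodule.Build k presented
  pres_scaleA pres_scale1 pres_scaleDr pres_scaleDl.

Definition gen : X -> presented := locked (fun p => pi_pres << p >>).

Lemma genE p : gen p = pi_pres << p >>.
Proof. by rewrite /gen -lock. Qed.

Section Lift.
Variable Y : lmodType k.

Definition malg_lift (f : X -> Y) x : Y := \sum_(p <- msupp x) x@_p *: f p.

Lemma malg_liftw f x (D : {fset X}) : (msupp x `<=` D)%fset ->
  malg_lift f x = \sum_(p <- D) x@_p *: f p.
Proof.
move=> sub; rewrite /malg_lift; apply: big_fset_incl => // p _ px.
by rewrite (mcoeff_outdom px) scale0r.
Qed.

Lemma malg_lift_is_linear f : linear (malg_lift f).
Proof.
move=> c x y; set D := (msupp x `|` msupp y)%fset.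
have sx : (msupp x `<=` D)%fset by apply: fsubsetUl.
have sy : (msupp y `<=` D)%fset by apply: fsubsetUr.
have sxy : (msupp (c *: x + y) `<=` D)%fset.
  apply: (fsubset_trans (msuppD_le _ _)); apply: fsetSU; exact: msuppZ_le.
rewrite (malg_liftw _ sx) (malg_liftw _ sy) (malg_liftw _ sxy).
rewrite scaler_sumr -big_split; apply: eq_bigr => p _ /=.
by rewrite mcoeffD mcoeffZ scalerDl scalerA.
Qed.

HB.instance Definition _ f := GRing.isLinear.Build k {malg k[X]} Y _
  (malg_lift f) (malg_lift_is_linear f).

Lemma malg_liftU f p : malg_lift f << p >> = f p.
Proof.
by rewrite (malg_liftw _ msuppU_le) big_seq_fset1 mcoeffUU scale1r.
Qed.

Definition respects (f : X -> Y) := forall r, R r -> malg_lift f r = 0.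

(* Depends on the chosen representative of q unless f respects R. *)
Definition lift (f : X -> Y) : presented -> Y :=
  locked (fun q => malg_lift f (repr q)).

Lemma liftE f q : lift f q = malg_lift f (repr q).
Proof. by rewrite /lift -lock. Qed.

Lemma lift_pi f x : respects f -> lift f (pi_pres x) = malg_lift f x.
Proof.
move=> fR; apply/eqP; rewrite -subr_eq0 liftE -linearB; apply/eqP.
elim: (repr_pi_pres x) => [|c r y Rr _ IH]; first exact: raddf0.
by rewrite linearP /= IH fR // scaler0 addr0.
Qed.

Lemma lift_gen f p : respects f -> lift f (gen p) = f p.
Proof. by move=> fR; rewrite genE lift_pi // malg_liftU. Qed.

Lemma lift_is_linear f : respects f -> linear (lift f).
Proof.
move=> fR c q r; rewrite -[q]pi_pres_repr -[r]pi_pres_repr.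
by rewrite -[c *: pi_pres _]pi_presZ -pi_presD !lift_pi // linearP.
Qed.

Lemma lift_fun_linear c f g q :
  lift (fun p => c *: f p + g p) q = c *: lift f q + lift g q.
Proof.
rewrite !liftE /malg_lift scaler_sumr -big_split; apply: eq_bigr => p _ /=.
by rewrite scalerDr !scalerA mulrC.
Qed.

Lemma lift0 q : lift (fun=> 0) q = 0.
Proof. by rewrite !liftE /malg_lift big1 // => p _; rewrite scaler0. Qed.

Lemma eq_lift f g : f =1 g -> lift f =1 lift g.
Proof. by move=> fg q; rewrite !liftE; apply: eq_bigr => p _; rewrite fg. Qed.

End Lift.

Lemma pres_ind (P : presented -> Prop) : P 0 ->
  (forall c p q, P q -> P (c *: gen p + q)) -> forall q, P q.
Proof.
move=> P0 PZ q; rewrite -[q]pi_pres_repr [repr q]monalgE.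
elim: (enum_fset (msupp (repr q))) => [|p s IH].
  by rewrite big_nil pi_pres0.
rewrite big_cons pi_presD.
suff -> : << (repr q)@_p *g p >> = (repr q)@_p *: << p >>.
  by rewrite pi_presZ -genE; apply: PZ.
by apply/malgP => p'; rewrite mcoeffZ !mcoeffU mulr_natr.
Qed.

Lemma lin_ext (Y : lmodType k) (f g : presented -> Y) :
  linear f -> linear g -> (forall p, f (gen p) = g (gen p)) -> f =1 g.
Proof.
move=> fl gl fg; apply: pres_ind => [|c p q IH]; last by rewrite fl gl fg IH.
by move: (fl (-1) 0 0) (gl (-1) 0 0);
  rewrite !scaler0 !addr0 !scaleN1r !addNr => -> ->.
Qed.

End Presented.

Section TensorAlgebra.
Variables (k : fieldType) (V : lmodType k).
Implicit Types (u v w : seq V).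

Definition talg_rel (r : {malg k[seq V]}) : Prop :=
  exists u w (c : k) (x y : V), r =
    << u ++ (c *: x + y) :: w >> - c *: << u ++ x :: w >> - << u ++ y :: w >>.

Definition multilinear (Y : lmodType k) (f : seq V -> Y) : Prop :=
  forall u w (c : k) (x y : V),
    f (u ++ (c *: x + y) :: w) = c *: f (u ++ x :: w) + f (u ++ y :: w).

Lemma multilinear_respects (Y : lmodType k) (f : seq V -> Y) :
  multilinear f -> respects talg_rel f.
Proof.
move=> fm r [u [w [c [x [y ->]]]]].
by rewrite !linearB linearZ /= !malg_liftU fm addrAC addrK subrr.
Qed.

Definition talg := presented talg_rel.
HB.instance Definition _ := GRing.Lmodule.on talg.

Definition word w : talg := gen talg_rel w.

Lemma word_multilinear : multilinear word.
Proof.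
move=> u w c x y; apply/eqP; rewrite -subr_eq0 opprD addrA; apply/eqP.
rewrite /word !genE -[c *: pi_pres _ _]pi_presZ -!pi_presB.
rewrite -[0](pi_pres0 talg_rel); apply/pi_pres_eq; rewrite subr0 -[X in spanned _ X]scale1r -[_ *: _]addr0.
by apply: spanned_Z; [exists u, w, c, x, y | constructor].
Qed.

Definition talg_lift (Y : lmodType k) (f : seq V -> Y) : talg -> Y :=
  lift (R := talg_rel) f.

Lemma talg_lift_word (Y : lmodType k) (f : seq V -> Y) w :
  multilinear f -> talg_lift f (word w) = f w.
Proof. by move=> fm; apply: lift_gen; apply: multilinear_respects. Qed.

Lemma talg_lift_linear (Y : lmodType k) (f : seq V -> Y) :
  multilinear f -> linear (talg_lift f).
Proof. by move=> fm; apply: lift_is_linear; apply: multilinear_respects. Qed.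

Lemma talg_ext (Y : lmodType k) (f g : talg -> Y) :
  linear f -> linear g -> (forall w, f (word w) = g (word w)) -> f =1 g.
Proof. exact: lin_ext. Qed.

Definition talg_mul : talg -> talg -> talg := locked (fun s t =>
  talg_lift (fun u => talg_lift (fun w => word (u ++ w)) t) s).

Lemma catl_multilinear u : multilinear (fun w => word (u ++ w)).
Proof. by move=> v w c x y; rewrite !catA word_multilinear. Qed.

Lemma talg_mul_linear_r s : linear (talg_mul s).
Proof.
move=> c t1 t2; rewrite /talg_mul -lock -lift_fun_linear; apply: eq_lift => u.
exact/talg_lift_linear/catl_multilinear.
Qed.

Lemma catr_multilinear t :
  multilinear (fun u => talg_lift (fun w => word (u ++ w)) t).
Proof.
move=> u w c x y; rewrite -lift_fun_linear; apply: eq_lift => v.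
by rewrite -!catA !cat_cons word_multilinear.
Qed.

Lemma talg_mul_linear_l t : linear (talg_mul^~ t).
Proof.
rewrite /talg_mul -lock => c s1 s2; exact/talg_lift_linear/catr_multilinear.
Qed.

Lemma talg_mul_word u w : talg_mul (word u) (word w) = word (u ++ w).
Proof.
rewrite /talg_mul -lock talg_lift_word; last exact: catr_multilinear.
by rewrite talg_lift_word //; apply: catl_multilinear.
Qed.

Lemma comp_linear (Y Z W : lmodType k) (f : Y -> Z) (g : Z -> W) :
  linear f -> linear g -> linear (fun x => g (f x)).
Proof. by move=> fl gl c x y; rewrite fl gl. Qed.

Fact talg_mulA : associative talg_mul.
Proof.
move=> s t r; move: s; apply: talg_ext.
- exact: talg_mul_linear_l.
- by apply: (@comp_linear _ _ _ (talg_mul^~ t) (talg_mul^~ r));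
    apply: talg_mul_linear_l.
move=> u; move: t; apply: talg_ext.
- by apply: (@comp_linear _ _ _ (talg_mul^~ r) (talg_mul (word u)));
    [apply: talg_mul_linear_l | apply: talg_mul_linear_r].
- by apply: (@comp_linear _ _ _ (talg_mul (word u)) (talg_mul^~ r));
    [apply: talg_mul_linear_r | apply: talg_mul_linear_l].
move=> v; move: r; apply: talg_ext.
- by apply: (@comp_linear _ _ _ (talg_mul (word v)) (talg_mul (word u)));
    apply: talg_mul_linear_r.
- exact: talg_mul_linear_r.
by move=> w; rewrite !talg_mul_word catA.
Qed.

Fact talg_mul1 : left_id (word [::]) talg_mul.
Proof.
apply: talg_ext => [||w]; first exact: talg_mul_linear_r.
  by move=> c x y.
by rewrite talg_mul_word.
Qed.

Fact talg_mulr1 : right_id (word [::]) talg_mul.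
Proof.
apply: talg_ext => [||w]; first exact: talg_mul_linear_l.
  by move=> c x y.
by rewrite talg_mul_word cats0.
Qed.

Fact talg_mulDl : left_distributive talg_mul +%R.
Proof.
by move=> s1 s2 t; have := talg_mul_linear_l t 1 s1 s2; rewrite !scale1r.
Qed.

Fact talg_mulDr : right_distributive talg_mul +%R.
Proof.
by move=> t s1 s2; have := talg_mul_linear_r t 1 s1 s2; rewrite !scale1r.
Qed.

(* The projection onto the degree-zero component k of the tensor algebra. *)
Definition taug : talg -> k^o := talg_lift (fun w => (nilp w)%:R : k^o).

Fact taug_multilinear : multilinear (fun w => (nilp w)%:R : k^o).
Proof.
by move=> u w c x y; rewrite /nilp !size_cat !addnS scaler0 addr0.
Qed.

HB.instance Definition _ := GRing.isLinear.Build k talg k^o _ taug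
  (talg_lift_linear taug_multilinear).

Lemma taug_word w : taug (word w) = (nilp w)%:R.
Proof. by rewrite /taug talg_lift_word //; apply: taug_multilinear. Qed.

Fact talg_1_neq0 : word [::] != 0.
Proof.
by apply/eqP => /(congr1 taug) /eqP; rewrite taug_word linear0 oner_eq0.
Qed.

HB.instance Definition _ := GRing.Zmodule_isNzRing.Build talg
  talg_mulA talg_mul1 talg_mulr1 talg_mulDl talg_mulDr talg_1_neq0.

Fact talg_scaleAl (c : k) (s t : talg) : c *: (s * t) = (c *: s) * t.
Proof.
have E : (c *: s + 0) * t = c *: (s * t) + 0 * t.
  exact: (talg_mul_linear_l t c s 0).
by rewrite mul0r !addr0 in E.
Qed.

HB.instance Definition _ := GRing.Lmodule_isLalgebra.Build k talg talg_scaleAl.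

Fact talg_scaleAr (c : k) (s t : talg) : c *: (s * t) = s * (c *: t).
Proof.
have E : s * (c *: t + 0) = c *: (s * t) + s * 0.
  exact: (talg_mul_linear_r s c t 0).
by rewrite mulr0 !addr0 in E.
Qed.

HB.instance Definition _ := GRing.Lalgebra_isAlgebra.Build k talg talg_scaleAr.

Lemma wordM u w : word u * word w = word (u ++ w).
Proof. exact: talg_mul_word. Qed.

Lemma word0 : word [::] = 1. Proof. by []. Qed.

Lemma taug1 : taug 1 = 1. Proof. by rewrite -word0 taug_word. Qed.

(* The space of tensors of positive degree. *)
Definition tpos_pred : {pred talg} := fun t => taug t == 0.

Fact tpos_closed : subsemimod_closed tpos_pred.
Proof.
split; first split; rewrite /tpos_pred.
- by apply/eqP; apply: linear0.
- by move=> x y /eqP x0 /eqP y0; apply/eqP; rewrite linearD /= x0 y0 addr0.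
- by move=> c x /eqP x0; apply/eqP; rewrite linearZ /= x0 scaler0.
Qed.

HB.instance Definition _ :=
  GRing.isSubmodClosed.Build k talg tpos_pred tpos_closed.

Record tpos := Tpos { tpos_val : talg; tpos_valP : tpos_val \in tpos_pred }.

HB.instance Definition _ := [isSub for tpos_val].
HB.instance Definition _ := [Choice of tpos by <:].
HB.instance Definition _ := [SubChoice_isSubZmodule of tpos by <:].
HB.instance Definition _ := [SubZmodule_isSubLmodule of tpos by <:].

Fact tpos_val_linear : linear tpos_val.
Proof. exact: (linearP (\val : tpos -> talg)). Qed.

HB.instance Definition _ :=
  GRing.isLinear.Build k tpos talg _ tpos_val tpos_val_linear.

(* Only meaningful for nonempty w; tword [::] is 0. *)
Definition tword w : tpos := insubd 0 (word w).

Lemma val_tword w : ~~ nilp w -> tpos_val (tword w) = word w.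
Proof.
by move=> w0; rewrite [LHS]val_insubd unfold_in taug_word (negPf w0) eqxx.
Qed.

End TensorAlgebra.

Section AlgebraLift.
Variables (k : fieldType) (V : lmodType k) (B : algType k) (g : {linear V -> B}).

Fact prod_multilinear : multilinear (fun w => \prod_(v <- w) g v).
Proof.
move=> u w c x y; rewrite !big_cat !big_cons /= linearP mulrDl mulrDr.
by rewrite scalerAr scalerAl.
Qed.

Definition talg_alg_lift : talg V -> B :=
  talg_lift (fun w => \prod_(v <- w) g v).

HB.instance Definition _ := GRing.isLinear.Build k (talg V) B _ talg_alg_lift
  (talg_lift_linear prod_multilinear).

Lemma talg_alg_lift_word w : talg_alg_lift (word w) = \prod_(v <- w) g v.
Proof. exact/talg_lift_word/prod_multilinear. Qed.

Fact talg_alg_lift_monoid_morphism : monoid_morphism talg_alg_lift.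
Proof.
split; first by rewrite -word0 talg_alg_lift_word big_nil.
move=> s t; move: s; apply: talg_ext => [||u].
- by move=> c x y; rewrite mulrDl -scalerAl linearP.
- by move=> c x y; rewrite linearP mulrDl -scalerAl.
move: t; apply: talg_ext => [||w].
- by move=> c x y; rewrite mulrDr -scalerAr linearP.
- by move=> c x y; rewrite linearP mulrDr -scalerAr.
by rewrite wordM !talg_alg_lift_word big_cat.
Qed.

HB.instance Definition _ := GRing.isMonoidMorphism.Build (talg V) B
  talg_alg_lift talg_alg_lift_monoid_morphism.

End AlgebraLift.

Section TensorProduct.
Variables (k : fieldType) (M N : lmodType k).

Definition tens_rel (r : {malg k[(M * N)%type]}) : Prop :=
  (exists (c : k) (x y : M) (z : N),
     r = << (c *: x + y, z) >> - c *: << (x, z) >> - << (y, z) >>) \/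
  (exists (c : k) (x : M) (y z : N),
     r = << (x, c *: y + z) >> - c *: << (x, y) >> - << (x, z) >>).

Definition tens := presented tens_rel.
HB.instance Definition _ := GRing.Lmodule.on tens.

Definition pure (x : M) (y : N) : tens := gen tens_rel (x, y).

Definition is_bilinear (Y : lmodType k) (f : M -> N -> Y) : Prop :=
  (forall z, linear (f^~ z)) /\ (forall x, linear (f x)).

Lemma pure_bilinear : is_bilinear pure.
Proof.
have E0 := esym (pi_pres0 tens_rel).
have Sr r : tens_rel r -> spanned tens_rel (r - 0).
  move=> rr; rewrite subr0 -[r]scale1r -[_ *: _]addr0.
  by apply: spanned_Z => //; constructor.
by split=> [z c x y|x c y z]; apply/eqP; rewrite -subr_eq0 opprD addrA;
  apply/eqP; rewrite /pure !genE -[c *: pi_pres _ _]pi_presZ -!pi_presB E0;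
  apply/pi_pres_eq/Sr; [left; exists c, x, y, z | right; exists c, x, y, z].
Qed.

Definition tens_lift (Y : lmodType k) (f : M -> N -> Y) : tens -> Y :=
  lift (R := tens_rel) (fun p => f p.1 p.2).

Lemma bilinear_respects (Y : lmodType k) (f : M -> N -> Y) :
  is_bilinear f -> respects tens_rel (fun p => f p.1 p.2).
Proof.
move=> [fl fr] r [[c [x [y [z ->]]]]|[c [x [y [z ->]]]]];
  rewrite !linearB linearZ /= !malg_liftU /=.
- by rewrite fl addrAC addrK subrr.
- by rewrite fr addrAC addrK subrr.
Qed.

Lemma tens_lift_pure (Y : lmodType k) (f : M -> N -> Y) x y :
  is_bilinear f -> tens_lift f (pure x y) = f x y.
Proof. by move=> fb; rewrite /tens_lift lift_gen //; apply: bilinear_respects. Qed.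

Lemma tens_lift_linear (Y : lmodType k) (f : M -> N -> Y) :
  is_bilinear f -> linear (tens_lift f).
Proof. by move=> fb; apply: lift_is_linear; apply: bilinear_respects. Qed.

Lemma tens_ext (Y : lmodType k) (f g : tens -> Y) :
  linear f -> linear g -> (forall x y, f (pure x y) = g (pure x y)) -> f =1 g.
Proof. by move=> fl gl fg; apply: lin_ext => // -[x y]; apply: fg. Qed.

End TensorProduct.

Section TensorMap.
Variables (k : fieldType) (M N M' N' : lmodType k).
Variables (f : {linear M -> M'}) (g : {linear N -> N'}).

Definition tens_map : tens M N -> tens M' N' :=
  tens_lift (fun x y => pure (f x) (g y)).

Fact tens_map_bilinear : is_bilinear (fun x y => pure (f x) (g y)).
Proof.
have [pl pr] := pure_bilinear M' N'.
by split=> [z c x y|x c y z]; rewrite linearP (pl, pr).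
Qed.

HB.instance Definition _ := GRing.isLinear.Build k (tens M N) (tens M' N') _
  tens_map (tens_lift_linear tens_map_bilinear).

Lemma tens_map_pure x y : tens_map (pure x y) = pure (f x) (g y).
Proof. exact: tens_lift_pure tens_map_bilinear. Qed.

End TensorMap.

Section ScalarProduct.
Variable k : fieldType.

Definition mulk : tens k^o k^o -> k^o := tens_lift (fun x y : k^o => x * y).

Fact mulk_bilinear : is_bilinear (fun x y : k^o => x * y : k^o).
Proof.
split=> [z c x y|x c y z]; first by rewrite mulrDl scalerAl.
by rewrite mulrDr scalerAr.
Qed.

HB.instance Definition _ := GRing.isLinear.Build k (tens k^o k^o) k^o _
  mulk (tens_lift_linear mulk_bilinear).

Lemma mulk_pure x y : mulk (pure x y) = x * y.
Proof. exact: tens_lift_pure mulk_bilinear. Qed.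

End ScalarProduct.
Arguments mulk {k}.

(* The product (x (x) y)(x' (x) y') = xx' (x) yy' on a tensor product of two
   algebras; both factors are tensor algebras below, whose augmentations show
   that 1 (x) 1 is not 0. *)
Section TensorProductAlgebra.
Variables (k : fieldType) (B C : algType k).

Definition tens_mul : tens B C -> tens B C -> tens B C := locked (fun s t =>
  tens_lift (fun x y => tens_lift (fun x' y' => pure (x * x') (y * y')) t) s).

Fact tens_mul_bilinear_r x y :
  is_bilinear (fun (x' : B) (y' : C) => pure (x * x') (y * y')).
Proof.
have [pl pr] := pure_bilinear B C.
by split=> [z c a b|z c a b]; rewrite mulrDr -scalerAr (pl, pr).
Qed.

Lemma tens_mul_linear_r s : linear (tens_mul s).
Proof.
move=> c t1 t2; rewrite /tens_mul -lock -lift_fun_linear; apply: eq_lift => -[x y].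
exact/tens_lift_linear/tens_mul_bilinear_r.
Qed.

Fact tens_mul_bilinear_l t : is_bilinear (fun (x : B) (y : C) =>
  tens_lift (fun x' y' => pure (x * x') (y * y')) t).
Proof.
have [pl pr] := pure_bilinear B C.
by split=> [z c a b|z c a b]; rewrite -lift_fun_linear; apply: eq_lift => -[x y];
  rewrite mulrDl -scalerAl (pl, pr).
Qed.

Lemma tens_mul_linear_l t : linear (tens_mul^~ t).
Proof.
rewrite /tens_mul -lock => c s1 s2; exact/tens_lift_linear/tens_mul_bilinear_l.
Qed.

Lemma tens_mul_pure x y x' y' :
  tens_mul (pure x y) (pure x' y') = pure (x * x') (y * y').
Proof.
rewrite /tens_mul -lock tens_lift_pure; last exact: tens_mul_bilinear_l.
by rewrite tens_lift_pure //; apply: tens_mul_bilinear_r.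
Qed.

Fact tens_mulA : associative tens_mul.
Proof.
move=> s t r; move: s; apply: tens_ext.
- exact: tens_mul_linear_l.
- by apply: (comp_linear (f := tens_mul^~ t) (g := tens_mul^~ r));
    apply: tens_mul_linear_l.
move=> x y; move: t; apply: tens_ext.
- by apply: (comp_linear (f := tens_mul^~ r) (g := tens_mul (pure x y)));
    [apply: tens_mul_linear_l | apply: tens_mul_linear_r].
- by apply: (comp_linear (f := tens_mul (pure x y)) (g := tens_mul^~ r));
    [apply: tens_mul_linear_r | apply: tens_mul_linear_l].
move=> x' y'; move: r; apply: tens_ext.
- by apply: (comp_linear (f := tens_mul (pure x' y')) (g := tens_mul (pure x y)));
    apply: tens_mul_linear_r.
- exact: tens_mul_linear_r.
by move=> x'' y''; rewrite !tens_mul_pure !mulrA.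
Qed.

Fact tens_mul1 : left_id (pure 1 1) tens_mul.
Proof.
apply: tens_ext => [||x y]; [exact: tens_mul_linear_r | by move=> c x y |].
by rewrite tens_mul_pure !mul1r.
Qed.

Fact tens_mulr1 : right_id (pure 1 1) tens_mul.
Proof.
apply: tens_ext => [||x y]; [exact: tens_mul_linear_l | by move=> c x y |].
by rewrite tens_mul_pure !mulr1.
Qed.

Fact tens_mulDl : left_distributive tens_mul +%R.
Proof.
by move=> s1 s2 t; have := tens_mul_linear_l t 1 s1 s2; rewrite !scale1r.
Qed.

Fact tens_mulDr : right_distributive tens_mul +%R.
Proof.
by move=> t s1 s2; have := tens_mul_linear_r t 1 s1 s2; rewrite !scale1r.
Qed.

End TensorProductAlgebra.

Section TensorProductTalg.
Variables (k : fieldType) (V W : lmodType k).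
Local Notation T2 := (tens (talg V) (talg W)).

Fact tens_1_neq0 : pure 1 1 != 0 :> T2.
Proof.
apply/eqP => /(congr1 (tens_map (@taug k V) (@taug k W))).
rewrite tens_map_pure linear0 => /(congr1 mulk).
by rewrite mulk_pure linear0 /= !taug1 mulr1; apply/eqP/oner_neq0.
Qed.

HB.instance Definition _ := GRing.Zmodule_isNzRing.Build T2
  (@tens_mulA _ _ _) (@tens_mul1 _ _ _) (@tens_mulr1 _ _ _)
  (@tens_mulDl _ _ _) (@tens_mulDr _ _ _) tens_1_neq0.

Fact tens_scaleAl (c : k) (s t : T2) : c *: (s * t) = (c *: s) * t.
Proof.
have E : (c *: s + 0) * t = c *: (s * t) + 0 * t.
  exact: (tens_mul_linear_l t c s 0).
by rewrite mul0r !addr0 in E.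
Qed.

HB.instance Definition _ := GRing.Lmodule_isLalgebra.Build k T2 tens_scaleAl.

Fact tens_scaleAr (c : k) (s t : T2) : c *: (s * t) = s * (c *: t).
Proof.
have E : s * (c *: t + 0) = c *: (s * t) + s * 0.
  exact: (tens_mul_linear_r s c t 0).
by rewrite mulr0 !addr0 in E.
Qed.

HB.instance Definition _ := GRing.Lalgebra_isAlgebra.Build k T2 tens_scaleAr.

Lemma pureM x y x' y' :
  (pure x y : T2) * (pure x' y' : T2) = pure (x * x') (y * y').
Proof. exact: tens_mul_pure. Qed.

Lemma pure11 : pure 1 1 = 1 :> T2. Proof. by []. Qed.

End TensorProductTalg.

Section DoubleTensorAlgebra.
Variables (k : fieldType) (A : algType k).
Local Notation TA := (tpos A).
Local Notation H := (talg (tpos A)).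
Local Notation HH := (tens (talg (tpos A)) (talg (tpos A))).
Local Notation Lin := {linear talg (tpos A) -> k^o}.
Implicit Types (u w : seq A) (m : bitseq).

(* A word of letters of A as an element of H, the empty word being 1. *)
Definition letters w : H := if nilp w then 1 else word [:: tword w].

Definition barword (s : seq (seq A)) : H := \prod_(w <- s) letters w.

Lemma letters_multilinear : multilinear letters.
Proof.
move=> u w c x y.
have nz z : nilp (u ++ z :: w) = false by rewrite /nilp size_cat addnS.
have -> : forall z, letters (u ++ z :: w) = word [:: tword (u ++ z :: w)].
  by move=> z; rewrite /letters nz.
rewrite /letters !nz; rewrite -(word_multilinear [::] [::]) /=; congr word.
congr [:: _]; apply: val_inj; rewrite -[LHS]/(tpos_val _) -[RHS]/(tpos_val _).
by rewrite linearP /= !val_tword ?nz // word_multilinear.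
Qed.

(* A subset S of the positions of w is encoded by its indicator m, so that
   a_S is mask m w; gaps [::] m w lists the words formed by the letters lying
   before, between and after the elements of S. The nonempty ones are indexed
   by the connected components of the complement of S, and the empty ones
   contribute factors 1 to barword. *)
Fixpoint gaps (cur : seq A) m w : seq (seq A) :=
  match m, w with
  | b :: m', x :: w' =>
      if b then cur :: gaps [::] m' w' else gaps (rcons cur x) m' w'
  | _, _ => [:: cur]
  end.

Definition delta_word w : HH :=
  \sum_(m : (size w).-tuple bool)
     pure (letters (mask m w)) (barword (gaps [::] m w)).

Lemma gaps_cur_multilinear m w cur cur' (c : k) (x y : A) :
  barword (gaps (cur ++ (c *: x + y) :: cur') m w) =
    c *: barword (gaps (cur ++ x :: cur') m w) +
    barword (gaps (cur ++ y :: cur') m w).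
Proof.
rewrite /barword; elim: m w cur' => [|b m IH] [|z w] cur' /=;
  rewrite ?big_seq1 ?letters_multilinear //.
case: b; last by rewrite !rcons_cat /= IH.
by rewrite !big_cons letters_multilinear mulrDl scalerAl.
Qed.

Lemma gaps_multilinear m u w cur (c : k) (x y : A) :
  size m = size (u ++ x :: w) -> nth true m (size u) = false ->
  barword (gaps cur m (u ++ (c *: x + y) :: w)) =
    c *: barword (gaps cur m (u ++ x :: w)) +
    barword (gaps cur m (u ++ y :: w)).
Proof.
elim: u m cur => [|z u IH] [|b m] cur //=.
  by move=> _ ->; rewrite -!cats1 gaps_cur_multilinear.
move=> [sm] mu; case: b; last exact: IH.
by rewrite /barword !big_cons -!/(barword _) IH // mulrDr scalerAr.
Qed.

Lemma gaps_const m u w cur (x y : A) :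
  size m = size (u ++ x :: w) -> nth true m (size u) ->
  gaps cur m (u ++ x :: w) = gaps cur m (u ++ y :: w).
Proof.
elim: u m cur => [|z u IH] [|b m] cur //=; first by move=> _ ->.
by move=> [sm] mu; rewrite !(IH m).
Qed.

Lemma mask_const m u w (x y : A) :
  size m = size (u ++ x :: w) -> nth true m (size u) = false ->
  mask m (u ++ x :: w) = mask m (u ++ y :: w).
Proof.
elim: u m => [|z u IH] [|b m] //=; first by move=> _ ->.
by move=> [sm] mu; rewrite !(IH m).
Qed.

Lemma mask_split m u w (x : A) :
  size m = size (u ++ x :: w) -> nth true m (size u) ->
  exists u' w', forall y, mask m (u ++ y :: w) = u' ++ y :: w'.
Proof.
elim: u m => [|z u IH] [|b m] //=.
  by move=> _ ->; exists [::], (mask m w).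
move=> [sm] mu; have [u' [w' E]] := IH m sm mu.
by case: b; [exists (z :: u'), w' | exists u', w'] => y; rewrite E.
Qed.

Fact delta_word_multilinear : multilinear delta_word.
Proof.
have [pl pr] := pure_bilinear H H.
move=> u w c x y; rewrite /delta_word !size_cat /= scaler_sumr -big_split /=.
apply: eq_bigr => m _.
have sm z : size m = size (u ++ z :: w) by rewrite size_tuple size_cat.
have [mu|/negbTE mu] := boolP (nth true m (size u)).
  have [u' [w' E]] := mask_split (sm x) mu.
  rewrite !E letters_multilinear (pl _ c).
  have G z z' : gaps [::] m (u ++ z :: w) = gaps [::] m (u ++ z' :: w).
    exact: (gaps_const _ _ (sm _)).
  by rewrite (G _ x) (G y x).
rewrite gaps_multilinear // [LHS](pr _ c (barword _) (barword _)).
have G z z' : mask m (u ++ z :: w) = mask m (u ++ z' :: w).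
  exact: (mask_const _ (sm _)).
by rewrite (G _ x) (G y x).
Qed.

Definition delta_tpos (t : TA) : HH := talg_lift delta_word (tpos_val t).

Fact delta_tpos_linear : linear delta_tpos.
Proof.
move=> c s t; rewrite /delta_tpos linearP.
exact: talg_lift_linear delta_word_multilinear _ _ _.
Qed.

HB.instance Definition _ :=
  GRing.isLinear.Build k TA HH _ delta_tpos delta_tpos_linear.

Definition Delta : H -> HH := talg_alg_lift delta_tpos.
HB.instance Definition _ := GRing.Linear.on Delta.
HB.instance Definition _ := GRing.RMorphism.on Delta.

Lemma Delta_letters w : Delta (letters w) = delta_word w.
Proof.
rewrite /letters; case: ifP => [|/negbT w0].
  case: w => // _; rewrite rmorph1 /delta_word (big_pred1 [tuple]).
    by rewrite /barword /= big_seq1.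
  by move=> m /=; rewrite [m]tuple0; apply/esym/eqP.
rewrite /Delta talg_alg_lift_word big_seq1 /= /delta_tpos val_tword //.
by rewrite talg_lift_word //; apply: delta_word_multilinear.
Qed.

Definition counit : Lin := @taug k TA.

Definition conv (f g : Lin) : Lin := mulk \o tens_map f g \o Delta.

Definition conv_pow (f : Lin) (j : nat) : Lin := iter j (conv^~ f) counit.

(* A finitely supported sum: if f 1 = 0, then conv_pow f j vanishes on the
   elements of degree less than j. *)
Definition exp_conv (f : Lin) (x : H) : k :=
  \sum_(j \in [set: nat]) (j`!%:R)^-1 * conv_pow f j x.

Definition character (f : Lin) : Prop :=
  f 1 = 1 /\ forall x y, f (x * y) = f x * f y.

Definition infinitesimal_character (f : Lin) : Prop :=
  f 1 = 0 /\ forall x y : tpos TA, f (tpos_val x * tpos_val y) = 0.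

Section Extension.
Variable phi : {linear A -> k^o}.

Definition phi_word w : k^o := phi (\prod_(a <- w) a).

Fact phi_word_multilinear : multilinear phi_word.
Proof.
move=> u w c x y; rewrite /phi_word !big_cat !big_cons /=.
by rewrite mulrDl mulrDr -scalerAl -scalerAr linearP.
Qed.

Definition phi_tpos (t : TA) : k^o := talg_lift phi_word (tpos_val t).

Fact phi_tpos_linear : linear phi_tpos.
Proof.
move=> c s t; rewrite /phi_tpos linearP.
exact: talg_lift_linear phi_word_multilinear _ _ _.
Qed.

HB.instance Definition _ :=
  GRing.isLinear.Build k TA k^o _ phi_tpos phi_tpos_linear.

Definition Phi : Lin := talg_alg_lift phi_tpos.

Lemma Phi_letters w : phi 1 = 1 -> Phi (letters w) = phi_word w.
Proof.
move=> phi1; rewrite /letters; case: ifP => [|/negbT w0].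
  by case: w => //= _; rewrite rmorph1 /phi_word big_nil.
rewrite /Phi /= talg_alg_lift_word big_seq1 /= /phi_tpos val_tword //.
by rewrite talg_lift_word //; apply: phi_word_multilinear.
Qed.

Lemma Phi_character : character Phi.
Proof. by split=> [|x y] /=; rewrite ?rmorph1 ?rmorphM. Qed.

End Extension.
End DoubleTensorAlgebra.

(* i_0, ..., i_s with 1 = i_0 < i_1 < ... < i_s = n + 1. *)
Definition chain (n s : nat) (i : {ffun 'I_s.+1 -> 'I_n.+2}) : bool :=
  [&& (i ord0 == 1 :> nat)%N, (i ord_max == n.+1 :> nat)%N &
      [forall p : 'I_s.+1, forall q : 'I_s.+1, (p < q)%N ==> (i p < i q)%N]].

Definition monotone_rhs (k : fieldType) (h : nat -> k) (n : nat) : k :=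
  \sum_(1 <= s < n.+1) \sum_(i : {ffun 'I_s.+1 -> 'I_n.+2} | chain i)
    (s`!%:R)^-1 * \prod_(1 <= j < s.+1)
      ((i (inord j.-1))%:R * h (i (inord j) - i (inord j.-1))%N).

(* Only the values h 1, h 2, ... are constrained. *)
Definition monotone_cumulants (k : fieldType) (A : algType k)
    (phi : {linear A -> k^o}) (a : A) (h : nat -> k) : Prop :=
  (forall n, (1 <= n)%N -> phi (a ^+ n) = monotone_rhs h n) /\
  (forall h' : nat -> k,
     (forall n, (1 <= n)%N -> phi (a ^+ n) = monotone_rhs h' n) ->
     forall n, (1 <= n)%N -> h' n = h n).

(* Main.v *)
Require Import Defs.
From mathcomp Require Import all_boot all_algebra.
From mathcomp Require Import fsbigop.

(** The infinitesimal character [rho] kills every product of two positive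
    elements, so in [f * rho], evaluated on the word a^n, only those subsets S
    of the n positions survive whose complement is a single nonempty interval.
    If S has j < n elements, this interval has length n - j and can be inserted
    at j + 1 places, whence ([conv_nseq])
      (f * rho)(a^n) = \sum_(j < n) (j + 1) f(a^j) h_(n-j).

    The convolution powers of [rho] are formed by multiplying by [rho] on the
    right, so their values on powers of a satisfy this recursion, which starts
    at the counit. The sums over chains 1 = i_0 < ... < i_s = n + 1 satisfy the
    same recursion: splitting off the last step, with i_(s-1) = j + 1,
    contributes the factor i_(s-1) h_(n-j). Both are therefore equal to
    [chain_sum] ([conv_pow_nseq], [sum_chain_weight]). A chain of s steps needs
    n >= s, which truncates the exponential series at s = n, and
    Phi = exp(rho) at a^n becomes the claimed formula.

    The relation determines the h_n because its term s = 1 is h_n itself, while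
    a chain with at least two steps has all its gaps smaller than n
    ([monotone_rhs_inj]). *)

Set Implicit Arguments.
Unset Strict Implicit.
Unset Printing Implicit Defensive.

Import GRing.Theory.
Local Open Scope ring_scope.

(** * Convolution by an infinitesimal character on the right *)

Section ConvolutionPowers.
Variables (k : fieldType) (A : algType k).
Local Notation TA := (tpos A).
Local Notation H := (talg (tpos A)).
Local Notation Lin := {linear talg (tpos A) -> k^o}.
Implicit Types (f g rho : Lin) (w : seq A) (ws : seq (seq A)) (ts : seq TA).

(** An infinitesimal character sees only how many tensor factors a bar word has,
    and an empty component, being 1, does not count as one. *)
Lemma barwordE ws :
  barword ws = word [seq tword w | w <- ws & ~~ nilp w].
Proof.
rewrite /barword; elim: ws => [|w ws IH]; first by rewrite big_nil word0.
rewrite big_cons IH /letters /=.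
by case: ifP => _ /=; rewrite ?mul1r ?wordM.
Qed.

Lemma infinitesimal_word rho ts :
  infinitesimal_character rho -> size ts != 1 -> rho (word ts) = 0.
Proof.
case=> rho1 rhoM; case: ts => [|t [|t' ts]] // _.
have pos ts' : ~~ nilp ts' -> word ts' \in tpos_pred (V := TA).
  by move=> ts0; rewrite unfold_in taug_word (negPf ts0) eqxx.
rewrite -cat1s -wordM.
exact: (rhoM (Tpos (pos [:: t] isT)) (Tpos (pos (t' :: ts) isT))).
Qed.

(** Once one component is nonempty, any further nonempty one makes the bar word a
    product of two positive elements. *)
Lemma infinitesimal_barword_cons rho w ws :
  infinitesimal_character rho -> ~~ nilp w ->
  rho (barword (w :: ws)) = (all (@nilp A) ws)%:R * rho (letters w).
Proof.
move=> rho_inf w0; case: (boolP (all _ ws)) => ws0; rewrite ?mul1r ?mul0r.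
  rewrite /barword big_cons big1_seq ?mulr1 // => w' /(allP ws0).
  by rewrite /letters => ->.
rewrite barwordE infinitesimal_word //= w0 /= eqSS size_map size_filter.
by rewrite -lt0n -has_count has_predC.
Qed.

Lemma conv_letters f g w :
  conv f g (letters w) = \sum_(m : (size w).-tuple bool)
    f (letters (mask m w)) * g (barword (gaps [::] m w)).
Proof.
rewrite /conv /= Delta_letters /delta_word !linear_sum /=.
by apply: eq_bigr => m _; rewrite tens_map_pure mulk_pure.
Qed.

Lemma big_bitseqS n (F : bitseq -> k) :
  \sum_(m : n.+1.-tuple bool) F m =
  \sum_(m : n.-tuple bool) F (true :: m) +
  \sum_(m : n.-tuple bool) F (false :: m).
Proof.
pose cons_pair (p : bool * n.-tuple bool) := [tuple of p.1 :: p.2].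
rewrite (reindex cons_pair) /=; last first.
  exists (fun m => (thead m, [tuple of behead m])) => [[b m] _|m _] /=.
    by congr pair; apply: val_inj.
  by rewrite [RHS]tuple_eta.
by rewrite -(pair_bigA _ (fun b (m : n.-tuple bool) => F (b :: m))) big_bool.
Qed.

(** A gap that has started to collect letters can never become empty again, and
    every position outside S contributes a letter to some gap. *)
Lemma all_nilp_gaps m w : size m = size w ->
  all (@nilp A) (gaps [::] m w) = all id m.
Proof.
have nogap cur : ~~ nilp cur -> forall m w, ~~ all (@nilp A) (gaps cur m w).
  move=> cur0 {}m {}w; elim: m w cur cur0 => [|b m IH] [|x w] cur cur0 /=;
    rewrite ?(negPf cur0) //.
  case: b; rewrite /= ?(negPf cur0) //; apply: IH.
  by rewrite /nilp size_rcons.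
elim: m w => [|b m IH] [|x w] //= [sm]; case: b => /=; first exact: IH.
exact/negbTE/nogap.
Qed.

Section SingleLetter.
Variables (rho : Lin) (rho_inf : infinitesimal_character rho) (a : A).
Let h n : k := rho (letters (nseq n a)).

(** The state of [gaps] after c + 1 >= 1 letters outside S: a nonempty component
    is being read. It stops after n - j further letters, and then all the
    remaining j positions must lie in S, since a second component would be
    killed by [rho]. *)
Lemma sum_open_gap (F : nat -> k) c n :
  \sum_(m : n.-tuple bool)
     F (count id m) * rho (barword (gaps (nseq c.+1 a) m (nseq n a))) =
  \sum_(j < n.+1) F j * h (c.+1 + n - j).
Proof.
elim: n c => [|n IH] c.
  rewrite big_ord1 addn0 (big_pred1 [tuple]) => [|m]; last first.
    by rewrite [m]tuple0; apply/esym/eqP.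
  by rewrite /barword /= big_seq1.
rewrite (big_bitseqS _ (fun m => F (count id m) *
  rho (barword (gaps (nseq c.+1 a) m (nseq n.+1 a))))) /=.
rewrite -[RHS]/(\sum_(j < n.+2) _) big_ord_recr /= addrC.
congr (_ + _); last first.
  rewrite addnS -addSn -IH; apply: eq_bigr => m _.
  by rewrite add0n -cats1 -(nseqD c 1) addn1.
rewrite (bigD1 [tuple of nseq n true]) //= big1 ?addr0 => [|m mT].
  have -> : count id (nseq n true) = n by rewrite count_nseq mul1n.
  (* The gap is closed at once, and the rest of the word lies in S. *)
  rewrite infinitesimal_barword_cons // all_nilp_gaps ?size_nseq //.
  by rewrite all_nseq orbT mul1r add1n addnK.
rewrite infinitesimal_barword_cons // all_nilp_gaps ?size_tuple ?size_nseq //.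
rewrite (_ : all id m = false) ?mul0r ?mulr0 //; apply: contraNF mT => mT.
apply/eqP/val_inj => /=; rewrite -[in RHS](size_tuple m).
by apply/all_pred1P; apply: sub_all mT => -[].
Qed.

(** The weight j + 1 counts the positions of the single gap among j letters. In
    the induction it comes from j words whose first letter is in S, and one
    whose gap begins with the first letter. *)
Lemma sum_closed_gap (F : nat -> k) n :
  \sum_(m : n.-tuple bool)
     F (count id m) * rho (barword (gaps [::] m (nseq n a))) =
  \sum_(j < n) j.+1%:R * F j * h (n - j).
Proof.
elim: n F => [|n IH] F.
  rewrite big_ord0 big1 // => m _; rewrite [m]tuple0 /barword /= big_seq1.
  by case: rho_inf => rho1 _; rewrite [letters _]/= rho1 mulr0.
rewrite (big_bitseqS _ (fun m => F (count id m) *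
  rho (barword (gaps [::] m (nseq n.+1 a))))) /=.
under eq_bigr do rewrite /barword big_cons -/(barword _) mul1r.
rewrite (IH (fun j => F j.+1)).
rewrite (sum_open_gap F 0) add1n.
have -> : \sum_(j < n) j.+1%:R * F j.+1 * h (n - j) =
          \sum_(j < n.+1) j%:R * F j * h (n.+1 - j).
  by rewrite big_ord_recl /= !mul0r add0r; apply: eq_bigr => j _.
rewrite -big_split; apply: eq_bigr => j _ /=.
by rewrite -mulrA -[X in _ + X]mul1r -mulrDl -mulrSr mulrA.
Qed.

Lemma conv_nseq f n :
  conv f rho (letters (nseq n a)) =
  \sum_(j < n) j.+1%:R * f (letters (nseq j a)) * h (n - j).
Proof.
rewrite conv_letters -(sum_closed_gap (fun j => f (letters (nseq j a)))).
have mask_nseq (m : bitseq) : size m = n ->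
    mask m (nseq n a) = nseq (count id m) a.
  by elim: m n => [|b m IH] [|n'] //= [/IH ->]; case: b.
rewrite size_nseq; apply: eq_bigr => m _.
by rewrite mask_nseq ?size_tuple.
Qed.

End SingleLetter.
End ConvolutionPowers.

(** * Sums over chains *)

Section Chains.
Variable k : fieldType.
Implicit Types h : nat -> k.

(** The sum of the products i_0 h_(i_1 - i_0) ... i_(s-1) h_(i_s - i_(s-1)) over
    the chains 1 = i_0 < ... < i_s = n + 1; the index j of the recursion is
    i_(s-1) - 1. *)
Fixpoint chain_sum h s n : k :=
  if s is s'.+1 then \sum_(j < n) j.+1%:R * chain_sum h s' j * h (n - j)%N
  else (n == 0)%:R.

Lemma chain_sumS h s n : chain_sum h s.+1 n =
  \sum_(j < n) j.+1%:R * chain_sum h s j * h (n - j)%N.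
Proof. by []. Qed.

Lemma chain_sum_small h s n : (n < s)%N -> chain_sum h s n = 0.
Proof.
elim: s n => [|s IH] n //= lt_ns; apply: big1 => j _.
by rewrite IH ?mulr0 ?mul0r // (leq_trans (ltn_ord j)).
Qed.

Lemma chain_sum1 h n : (0 < n)%N -> chain_sum h 1 n = h n.
Proof.
case: n => // n _; rewrite /= big_ord_recl /= big1 => [|j _].
  by rewrite !mul1r addr0.
by rewrite mulr0 mul0r.
Qed.

Lemma eq_chain_sum h h' s n :
  (forall j, (0 < j <= n)%N -> h j = h' j) -> chain_sum h s n = chain_sum h' s n.
Proof.
elim: s n => [|s IH] n hh' //=; apply: eq_bigr => j _.
rewrite (IH j) => [|l /andP[l0 lj]]; last first.
  by rewrite hh' // l0 (leq_trans lj) // ltnW.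
by rewrite hh' // subn_gt0 ltn_ord leq_subr.
Qed.

(** In a chain with at least two steps no single gap exhausts the distance n from
    i_0 to i_s: in the recursion the term j = 0 vanishes because a chain
    with at least one step cannot stop at 1. *)
Lemma eq_chain_sum_top h h' s n : (1 < s)%N ->
  (forall j, (0 < j < n)%N -> h j = h' j) -> chain_sum h s n = chain_sum h' s n.
Proof.
case: s => [|[|s]] // _ hh'; rewrite !(chain_sumS _ s.+1).
case: n hh' => [|n] hh'; first by rewrite !big_ord0.
rewrite !big_ord_recl !chain_sum_small // !mulr0 !mul0r; congr (_ + _).
apply: eq_bigr => j _; rewrite (@eq_chain_sum h h') => [|l /andP[l0 lj]].
  by rewrite hh' // subn_gt0 ltn_ord /= subSS ltnS leq_subr.
by rewrite hh' // l0 (leq_ltn_trans lj (ltn_ord (lift ord0 j))).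
Qed.

Section ChainsAsFunctions.
Variables (h : nat -> k) (N : nat).
Local Notation I := 'I_N.+1.

(** The codomain bound N is kept apart from the endpoint l, so that the chain
    obtained by dropping the last point still has the same type of values. *)
Definition chain_to s (l : nat) (i : {ffun 'I_s.+1 -> I}) : bool :=
  [&& (i ord0 == 1 :> nat)%N, (i ord_max == l :> nat)%N &
      [forall p : 'I_s.+1, forall q : 'I_s.+1, (p < q)%N ==> (i p < i q)%N]].

Definition chain_weight s (i : {ffun 'I_s.+1 -> I}) : k :=
  \prod_(1 <= j < s.+1)
    ((i (inord j.-1))%:R * h (i (inord j) - i (inord j.-1))%N).

Definition extend s (p : {ffun 'I_s.+1 -> I} * I) : {ffun 'I_s.+2 -> I} :=
  [ffun q => if unlift ord_max q is Some r then p.1 r else p.2].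

Lemma extend_lift s p (r : 'I_s.+1) : extend p (lift ord_max r) = p.1 r.
Proof. by rewrite ffunE liftK. Qed.

Lemma extend_max s (p : {ffun 'I_s.+1 -> I} * I) : extend p ord_max = p.2.
Proof. by rewrite ffunE unlift_none. Qed.

Lemma extend_bij s : bijective (@extend s).
Proof.
exists (fun i : {ffun 'I_s.+2 -> I} =>
  ([ffun r => i (lift ord_max r)], i ord_max)) => [[g x]|i].
  rewrite extend_max; congr pair; apply/ffunP => r.
  by rewrite ffunE extend_lift.
apply/ffunP => q; case: (unliftP ord_max q) => [r|] ->.
  by rewrite extend_lift ffunE.
by rewrite extend_max.
Qed.

Lemma chain_to_extend s l (g : {ffun 'I_s.+1 -> I}) (x : I) :
  chain_to l (extend (g, x)) =
  [&& x == l :> nat, chain_to (g ord_max) g & (g ord_max < x)%N].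
Proof.
have e0 : ord0 = lift ord_max (ord0 : 'I_s.+1) by apply: val_inj.
rewrite /chain_to eqxx /= extend_max [in LHS]e0 extend_lift /=.
rewrite andbCA -andbA; congr (_ && (_ && _)).
apply/idP/andP => [/forallP mono|[/forallP mono lt_gx]].
  split; last first.
    have /forallP/(_ ord_max)/implyP := mono (lift ord_max ord_max).
    by rewrite extend_lift extend_max lift_max; apply.
  apply/forallP => p; apply/forallP => q; apply/implyP => pq.
  have /forallP/(_ (lift ord_max q))/implyP := mono (lift ord_max p).
  by rewrite !extend_lift !lift_max; apply.
apply/forallP => p; apply/forallP => q; apply/implyP.
case: (unliftP ord_max p) => [p'|] ->; last first.
  by rewrite ltnNge -ltnS ltn_ord.
case: (unliftP ord_max q) => [q'|] ->; rewrite !lift_max extend_lift.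
  rewrite extend_lift => lt_pq.
  by have /forallP/(_ q')/implyP/(_ lt_pq) := mono p'.
rewrite extend_max => _; apply: leq_ltn_trans lt_gx.
have [->//|p'max] := eqVneq p' ord_max.
have /forallP/(_ ord_max)/implyP lt_max := mono p'.
by apply/ltnW/lt_max; rewrite /= ltn_neqAle p'max -ltnS /=.
Qed.

Lemma chain_weight_extend s (g : {ffun 'I_s.+1 -> I}) (x : I) :
  chain_weight (extend (g, x)) =
  chain_weight g * ((g ord_max)%:R * h (x - g ord_max)).
Proof.
have inordE j : (j < s.+1)%N -> extend (g, x) (inord j) = g (inord j).
  move=> js; have -> : inord j = lift ord_max (inord j : 'I_s.+1).
    by apply: ord_inj; rewrite lift_max !inordK // ltnW.
  exact: extend_lift.
have inord_max n : inord n = ord_max :> 'I_n.+1.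
  by apply: val_inj; rewrite /= inordK.
rewrite /chain_weight big_nat_recr //= inordE // !inord_max extend_max.
congr (_ * _); apply: eq_big_nat => j /andP[j0 js].
by rewrite !inordE // (leq_ltn_trans (leq_pred j)).
Qed.

(** The points of a chain are positive, so l = 0 is the endpoint of no chain; the
    shift from l to n comes from chains starting at 1. *)
Lemma sum_chain_weight s (l : I) :
  \sum_(i : {ffun 'I_s.+1 -> I} | chain_to l i) chain_weight i =
  if (l : nat) is n.+1 then chain_sum h s n else 0.
Proof.
elim: s l => [|s IH] l.
  transitivity (\sum_(i : {ffun 'I_1 -> I} | i == [ffun=> l])
                  ((l == 1 :> nat)%:R : k)); last first.
    by rewrite big_pred1_eq; case: (l : nat) => // -[].
  rewrite big_mkcond [RHS]big_mkcond; apply: eq_bigr => i _.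
  rewrite /chain_weight big_nil /chain_to.
  have -> : [forall p : 'I_1, forall q : 'I_1, (p < q) ==> (i p < i q)]%N.
    by apply/forallP => p; apply/forallP => q; rewrite !ord1 ltnn.
  rewrite andbT (_ : ord_max = ord0); last exact: val_inj.
  have -> : (i == [ffun=> l]) = (i ord0 == l).
    apply/eqP/eqP => [->|il]; first by rewrite ffunE.
    by apply/ffunP => p; rewrite ord1 ffunE.
  rewrite -val_eqE /=; case: eqP => [i0|i0]; case: eqP => [il|il] //=.
  - by rewrite -il i0.
  - by case: eqP => // l1; case: i0; rewrite il.
(* Fix the truncated chain g first, then sort the g by their endpoint x. *)
transitivity (\sum_(g : {ffun 'I_s.+1 -> I} |
    chain_to (g ord_max) g && (g ord_max < l)%N)
      chain_weight g * ((g ord_max)%:R * h (l - g ord_max)%N)).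
  rewrite (reindex (@extend s)) /=; last exact/onW_bij/extend_bij.
  rewrite big_mkcond [RHS]big_mkcond /=.
  rewrite -(pair_bigA _ (fun g x => if chain_to l (extend (g, x))
                                    then chain_weight (extend (g, x)) else 0)).
  apply: eq_bigr => g _; rewrite (bigD1 l) //= big1 ?addr0 => [|x /negPf xl].
    by rewrite chain_to_extend eqxx chain_weight_extend.
  by rewrite chain_to_extend val_eqE xl.
rewrite (partition_big (fun g : {ffun 'I_s.+1 -> I} => g ord_max)
  (fun x : I => (x < l)%N)) /=; last by move=> g /andP[].
transitivity (\sum_(x : I | (x < l)%N)
    (if (x : nat) is n.+1 then chain_sum h s n else 0) *
      (x%:R * h (l - x)%N)).
  apply: eq_bigr => x lt_xl; rewrite -IH mulr_suml.
  apply: eq_big => [g|g /andP[_ /eqP -> //]].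
  have [gx|gx] := eqVneq (g ord_max) x; first by rewrite gx lt_xl !andbT.
  rewrite andbF /chain_to [(g ord_max == x :> nat)%N](val_eqE (g ord_max) x).
  by rewrite (negPf gx) !andbF.
pose F x := (if x is n.+1 then chain_sum h s n else 0) * (x%:R * h (l - x)%N).
rewrite -(big_ord_widen N.+1 F) ?(ltnW (ltn_ord l)) // /F.
case: (l : nat) => [|n]; first by rewrite big_ord0.
rewrite big_ord_recl /= mul0r add0r; apply: eq_bigr => x _.
by rewrite /= subSS mulrA [_ * x.+1%:R]mulrC.
Qed.

End ChainsAsFunctions.

End Chains.

(** * The exponential on powers of one letter *)

Section Exponential.
Variables (k : fieldType) (A : algType k).
Variables (rho : {linear talg (tpos A) -> k^o}).
Variables (rho_inf : infinitesimal_character rho) (a : A).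
Let h n : k := rho (letters (nseq n a)).

Lemma conv_pow_nseq s n :
  conv_pow rho s (letters (nseq n a)) = chain_sum h s n.
Proof.
elim: s n => [|s IH] n.
  rewrite /= /letters /nilp size_nseq; case: n => [|n] /=; first exact: taug1.
  by rewrite taug_word.
rewrite [LHS](conv_nseq rho_inf); apply: eq_bigr => j _.
by rewrite IH.
Qed.

Lemma exp_conv_nseq n :
  exp_conv rho (letters (nseq n a)) =
  \sum_(s < n.+1) (s`!%:R)^-1 * chain_sum h s n.
Proof.
pose F s := (s`!%:R)^-1 * chain_sum h s n.
apply/esym; rewrite [LHS](fsbig_ord _ _ F) /exp_conv.
under [RHS]eq_fsbigr do rewrite conv_pow_nseq.
apply: fsbig_widen => // s [_ /= /negP]; rewrite -leqNgt => lt_ns.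
by rewrite /F chain_sum_small ?mulr0.
Qed.

End Exponential.

Lemma monotone_rhsE (k : fieldType) (h : nat -> k) n :
  monotone_rhs h n = \sum_(1 <= s < n.+1) (s`!%:R)^-1 * chain_sum h s n.
Proof.
apply: eq_bigr => s _; rewrite -mulr_sumr; congr (_ * _).
exact: (sum_chain_weight h s (ord_max : 'I_n.+2)).
Qed.

(** The relation is triangular: its term s = 1 is h_n and all other terms involve
    only h_j with j < n. *)
Lemma monotone_rhs_inj (k : fieldType) (h h' : nat -> k) :
  (forall n, (1 <= n)%N -> monotone_rhs h' n = monotone_rhs h n) ->
  forall n, (1 <= n)%N -> h' n = h n.
Proof.
move=> eq_rhs n; elim/ltn_ind: n => n IH n_gt0.
have eq_tail : \sum_(2 <= s < n.+1) (s`!%:R)^-1 * chain_sum h' s n =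
               \sum_(2 <= s < n.+1) (s`!%:R)^-1 * chain_sum h s n.
  apply: eq_big_nat => s /andP[s_gt1 _]; congr (_ * _).
  by apply: eq_chain_sum_top => // j /andP[j0 jn]; rewrite IH.
have := eq_rhs n n_gt0; rewrite !monotone_rhsE !(@big_ltn _ _ _ 1) // eq_tail.
by move/addIr; rewrite !chain_sum1 // invr1 !mul1r.
Qed.

Theorem theorem2 (k : fieldType) (char0 : [pchar k] =i pred0)
    (A : algType k) (phi : {linear A -> k^o}) (phi1 : phi 1 = 1)
    (rho : {linear talg (tpos A) -> k^o})
    (rho_inf : infinitesimal_character rho)
    (rho_exp : forall x, Phi phi x = exp_conv rho x)
    (a : A) :
  let h : nat -> k := fun n => rho (letters (nseq n a)) in
  let m : nat -> k := fun l => Phi phi (letters (nseq l a)) in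
  [/\ forall l, m l = phi (a ^+ l),
      forall n, (1 <= n)%N ->
        m n = \sum_(1 <= s < n.+1)
                \sum_(i : {ffun 'I_s.+1 -> 'I_n.+2} | chain i)
                  (s`!%:R)^-1 * \prod_(1 <= j < s.+1)
                    ((i (inord j.-1))%:R * h (i (inord j) - i (inord j.-1))%N)
    & monotone_cumulants phi a h].
Proof.
move=> h m.
have mE l : m l = phi (a ^+ l).
  by rewrite /m Phi_letters // /phi_word big_nseq -Monoid.iteropE.
have m_rhs n : (1 <= n)%N -> m n = monotone_rhs h n.
  move=> n_gt0; rewrite /m rho_exp exp_conv_nseq // monotone_rhsE.
  rewrite -(big_mkord xpredT (fun s => (s`!%:R)^-1 * chain_sum _ s n)).
  (* The exponential series starts at s = 0, where the counit of a^n is 0. *)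
  by rewrite big_ltn // /= eqn0Ngt n_gt0 mulr0 add0r.
have phi_rhs n : (1 <= n)%N -> phi (a ^+ n) = monotone_rhs h n.
  by move=> n_gt0; rewrite -mE m_rhs.
split=> //; split=> // h' phi_rhs'; apply: monotone_rhs_inj => n n_gt0.
by rewrite -phi_rhs' // phi_rhs.
Qed.
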